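(* Let $q$ be a power of a prime $p$ and let $e,k$ be nontrivial divisors of $q-1$ such that $q=ek+1$. Let $a\in\{1,\dots,e-1\}$. If $$p>\left(\frac{4k}{\varphi(k)}\right)^{\frac{\varphi(k)}{2\operatorname{ord}_k(p)}},$$ then the cyclotomic number $(a,0)$ of order $e$ over $\mathbb{F}_q$ satisfies $$(a,0)\le\begin{cases}3&\text{if } 2\in C_a\text{ and }2\mid k,\\ 2&\text{if } 2\notin C_a\text{ and }2\mid k,\\ 2&\text{if } 2\nmid k.\end{cases}$$
   Context: A nontrivial divisor of $q-1$ is a divisor different from $1$ and $q-1$. $\operatorname{ord}_k(p)$ is the multiplicative order of $p$ modulo $k$ and $\varphi$ is Euler's totient function. Fix a primitive element $g$ of the finite field $\mathbb{F}_q$. For $a\in\mathbb{Z}$ let $C_a=\{g^a,g^{a+e},\dots,g^{a+(k-1)e}\}$, so that $C_a=C_{a+e}$. The cyclotomic number $(a,b)$ of order $e$ is the number of solutions of $1+x=y$ with $x\in C_a$, $y\in C_b$; equivalently, the number of pairs of integers $(r,s)$ with $0\le r,s\le k-1$ and $1+g^{a+re}=g^{b+se}$. In ''$2\in C_a$'', $2$ denotes the element $1+1$ of $\mathbb{F}_q$. *)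

(* Defs.v *)
From HB Require Import structures.
From mathcomp Require Import all_boot all_order all_algebra all_fingroup all_solvable.
From mathcomp Require Import reals exp.

Set Implicit Arguments.
Unset Strict Implicit.
Unset Printing Implicit Defensive.

Import GRing.Theory.
Local Open Scope ring_scope.

Definition nontrivial_divisor (d n : nat) : Prop :=
  [/\ (d %| n)%N, d <> 1%N & d <> n].

(* [insubd 1 x] is [x] seen as a unit, or 1 when [x] is not invertible, so
   [ord_mod k p] is meaningful for [1 < k] and [coprime k p]; see
   [ord_mod_dvdP]. *)
Definition ord_mod (k p : nat) : nat :=
  #[insubd (1%g : {unit 'Z_k}) (p%:R : 'Z_k)]%g.

Lemma ord_mod_dvdP (k p m : nat) : (1 < k)%N -> coprime k p ->
  (ord_mod k p %| m)%N = (p ^ m == 1 %[mod k])%N.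
Proof.
move=> k1 cop; rewrite /ord_mod order_dvdn.
have up : (p%:R : 'Z_k) \is a GRing.unit by rewrite unitZpE.
rewrite -val_eqE /= FinRing.val_unitX insubdK //= -natrX.
by rewrite -[1]/(1%:R) -val_eqE /= !val_Zp_nat ?Zp_cast.
Qed.

Section Cyclotomy.
Variables (F : finFieldType) (g : {unit F}) (e k : nat).

(* The exponent is an integer, [^] being [exprz] in [F]. *)
Definition cyclotomic_class (a : int) : {set F} :=
  [set val g ^ (a + (i * e)%N%:Z) | i : 'I_k].

Definition cyclotomic_number (a b : int) : nat :=
  #|[set xy : F * F | [&& xy.1 \in cyclotomic_class a,
      xy.2 \in cyclotomic_class b & 1 + xy.1 == xy.2]]|.

End Cyclotomy.

(* Main.v *)
Require Import Defs.
From HB Require Import structures.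
From mathcomp Require Import all_boot all_order all_algebra all_fingroup all_solvable.
From mathcomp Require Import all_field.
From mathcomp Require Import reals exp.
From mathcomp Require Import ring.

Set Implicit Arguments.
Unset Strict Implicit.
Unset Printing Implicit Defensive.

Import Order.TTheory GRing.Theory Num.Theory.
Local Open Scope ring_scope.

(** The class [C_0] is the group of [k]-th roots of unity of [F_q], and the
  quotient of two elements of [C_a] lies in it.  So a solution is a [k]-th root
  of unity [y] with [y - 1] in [C_a], and two solutions [x <> y] give a third
  [k]-th root of unity [z = (x - 1) / (y - 1)], hence an additive relation
  [x + z = 1 + z * y] between four of them.

  The bound on [p] makes such relations come from characteristic 0.  Let
  [h = \sum_(i < k) c_i X^i] be an integral polynomial with [\sum_i c_i^2 <= 4] that
  vanishes at a primitive [k]-th root of unity [eta] of [F_q].  The norm [N] of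
  [h] in [Z[X]/Phi_k] is an integer with two estimates:
  - it is divisible by [p ^ ord_k(p)], since the reduction of [h] modulo
    [p] vanishes at the [ord_k(p)] distinct conjugates [eta ^ (p ^ i)] of [eta], which bounds from
    below the corank modulo [p] of multiplication by [h]
    ([dvdz_det_of_kernel], via the Smith normal form);
  - it is the product of the complex values [h(zeta)] at the primitive [k]-th
    roots of unity, so [N^2 <= (4 k / phi(k)) ^ phi(k)] by the inequality
    between arithmetic and geometric means and Parseval's identity.
  The assumption on [p] forces [N = 0], that is, [h(zeta) = 0] for some complex
  primitive [zeta] ([vanishing_sum_lifts]).

  Over the complex numbers, [a + b = c + d] with roots of unity is only possible
  when the two pairs agree or when both sums are 0.  If the four terms of the
  relation are pairwise distinct, only the second case remains and it says
  [x * y = 1].  Otherwise [x = z] or [z * y = 1], and then [y + 1/x = 2] or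
  [x + 1/y = 2]; this cannot happen in characteristic 3, where the relation
  reads [1 + x + x * y = 0], has only three terms, and lifts as well.

  In the coordinate [w = (y - 1)^-1 + 1/2] these alternatives become affine:
  [w' = - w], or [w' = w + 1], or [w = w' + 1].  Elementary case analysis shows
  that three pairwise related values can only be [0], [1] and [-1]
  ([related_triple]).  Hence there are at most three solutions, and if there are
  three, then [w = 0] gives the solution [y = -1], so [k] is even, and [w = 1]
  gives [y = 3], so [2 = y - 1] is in [C_a]. *)

(** * Determinants of integer matrices that are singular modulo a prime *)

Lemma Vandermonde_unit (K : fieldType) (n : nat) (a : 'rV[K]_n) :
  injective (a 0) -> Vandermonde n a \in unitmx.
Proof.
move=> inj_a; rewrite unitmxE det_Vandermonde unitfE.
apply/prodf_neq0 => i _; apply/prodf_neq0 => j ltij.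
by rewrite subr_eq0 (inj_eq inj_a); apply: contraTneq ltij => ->; rewrite ltnn.
Qed.

Lemma rank_Vandermonde (K : fieldType) (n d : nat) (a : 'rV[K]_d) :
  (d <= n)%N -> injective (a 0) -> \rank (Vandermonde n a) = d.
Proof.
move=> led inj_a; apply/eqP; rewrite eqn_leq rank_leq_col /=.
have sub_V : Vandermonde d a = rowsub (widen_ord led) (Vandermonde n a).
  by apply/matrixP=> i j; rewrite !mxE.
rewrite -{1}(mxrank_unit (Vandermonde_unit inj_a)) sub_V.
by apply: mxrankS; apply/row_subP=> i; rewrite row_rowsub row_sub.
Qed.

(** In the Smith form [L *m D *m Q] of [M], the matrices [L] and [Q] stay invertible
  over [K], so [D] kills the rank [d] matrix [Q *m V]; this matrix then has at
  least [d] nonzero rows, and the diagonal entries of [D] at these rows are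
  divisible by [p]. *)
Lemma dvdz_det_of_kernel (K : fieldType) (p n d : nat) (M : 'M[int]_n)
    (V : 'M[K]_(n, d)) :
    prime p -> p \in [pchar K] -> map_mx intr M *m V = 0 -> \rank V = d ->
  ((p ^ d)%N %| \det M)%Z.
Proof.
move=> pr_p charKp MV0 rV.
have [L uL [Q uQ [s _ defM]]] := int_Smith_normal_form M.
set D := \matrix_(_, _) _ in defM.
have toK n' (A : 'M[int]_n') : A \in unitmx -> map_mx intr A \in @unitmx K n'.
  rewrite !unitmxE det_map_mx => /unitrPr[y Ay].
  by apply/unitrPr; exists y%:~R; rewrite -rmorphM Ay rmorph1.
pose I := [set i : 'I_n | (p %| absz (s`_i)%R)%N].
have DQV0 : map_mx intr D *m (map_mx intr Q *m V) = 0.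
  apply: (can_inj (mulKmx (toK _ _ uL))).
  by rewrite mulmx0 !mulmxA -!map_mxM -defM.
have pchar_int (z : int) : (z%:~R == 0 :> K) = (p %| absz z)%N.
  by rewrite (dvdn_pcharf charKp); case: z => m //; rewrite NegzE mulrNz oppr_eq0.
have row0 i : i \notin I -> row i (map_mx intr Q *m V) = 0.
  rewrite inE -pchar_int => nz; apply/rowP=> j; have /matrixP/(_ i j) := DQV0.
  rewrite mxE (bigD1 i) //= [X in _ + X]big1 ?addr0 => [|l neq].
    by rewrite !mxE eqxx => /eqP; rewrite mulf_eq0 (negPf nz) => /eqP.
  by rewrite !mxE eq_sym val_eqE (negPf neq) mul0r.
have ledI : (d <= #|I|)%N.
  have full_Q : row_full (map_mx intr Q : 'M[K]_n) by rewrite row_full_unit toK.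
  rewrite -rV -(eqmxMfull V full_Q); set W := _ *m V in row0 *.
  apply: leq_trans (rank_leq_row (rowsub (@enum_val _ (mem I)) W)).
  apply/mxrankS/row_subP=> i; have [Ii | /row0->] := boolP (i \in I); last exact: sub0mx.
  by rewrite -(enum_rankK_in Ii Ii) -row_rowsub row_sub.
have -> : \det M = \det L * (\prod_(i < n) s`_i) * \det Q.
  rewrite defM !det_mulmx; congr (_ * _ * _).
  have -> : D = diag_mx (\row_(i < n) s`_i) by apply/matrixP=> i j; rewrite !mxE.
  by rewrite det_diag; apply: eq_bigr => i _; rewrite mxE.
rewrite -mulrA; apply/dvdz_mull/dvdz_mulr.
rewrite (bigID (mem I)) /=; apply: dvdz_mulr.
apply: (@dvdz_trans (p ^ #|I|)%N); first by rewrite dvdzE /= dvdn_exp2l.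
rewrite -[Posz (p ^ _)]natz natrX -prodr_const.
elim/big_ind2: _ => // [x1 x2 y1 y2|i]; first exact: dvdz_mul.
by rewrite inE dvdzE natz.
Qed.

(** * The norm of a polynomial modulo a monic one *)

(** The matrix of multiplication by [f] on [Z[X] / (P)] in the basis of powers of
  ['X], acting on row vectors; its determinant is the norm of [f]. *)
Definition mulmod_mx (P f : {poly int}) (n : nat) : 'M[int]_n :=
  \matrix_(i, l) (Pdiv.Ring.rmodp ('X^i * f) P)`_l.

(** Evaluation at a root of [P] is a ring morphism on the quotient by [P], so the
  columns of the Vandermonde matrix at such roots are eigenvectors, with the
  values of [f] as eigenvalues.  The field is arbitrary: this is used both over
  the complex numbers and in characteristic [p], where all values of [f] vanish. *)
Lemma mulmod_mx_Vandermonde (K : fieldType) (P f : {poly int}) (n d : nat)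
    (a : 'rV[K]_d) :
    P \is monic -> size P = n.+1 ->
    (forall j, root (map_poly intr P) (a 0 j)) ->
  map_mx intr (mulmod_mx P f n) *m Vandermonde n a =
    Vandermonde n a *m diag_mx (\row_j (map_poly intr f).[a 0 j]).
Proof.
move=> monP szP Pa0; apply/matrixP=> i j; rewrite mul_mx_diag !mxE.
set r := Pdiv.Ring.rmodp ('X^i * f) P.
have szr : (size (map_poly intr r : {poly K}) <= n)%N.
  apply: leq_trans (size_poly _ _) _.
  by rewrite -ltnS -szP Pdiv.Ring.ltn_rmodpN0 ?monic_neq0.
transitivity (map_poly intr r).[a 0 j].
  by rewrite (horner_coef_wide _ szr); apply: eq_bigr => l _; rewrite !mxE coef_map.
have /(congr1 (fun s : {poly int} => (map_poly intr s).[a 0 j])) :=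
  Pdiv.RingMonic.rdivp_eq monP ('X^i * f).
rewrite !rmorphM rmorphD rmorphM /= map_polyXn hornerD !hornerM hornerXn -/r.
by rewrite (rootP (Pa0 j)) mulr0 add0r => ->.
Qed.

Lemma det_mulmod_mx (K : fieldType) (P f : {poly int}) (n : nat)
    (a : 'rV[K]_n) :
    P \is monic -> size P = n.+1 ->
    (forall j, root (map_poly intr P) (a 0 j)) -> injective (a 0) ->
  (\det (mulmod_mx P f n))%:~R = \prod_j (map_poly intr f).[a 0 j].
Proof.
move=> monP szP Pa0 inj_a.
have := congr1 determinant (mulmod_mx_Vandermonde f monP szP Pa0).
rewrite !det_mulmx det_diag det_map_mx mulrC => /mulfI ->.
  by apply: eq_bigr => j _; rewrite mxE.
by have := Vandermonde_unit inj_a; rewrite unitmxE unitfE.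
Qed.

(** * Complex roots of unity *)

Lemma conj_unity_root (C : numClosedFieldType) (k : nat) (z : C) :
  (0 < k)%N -> z ^+ k = 1 -> z^* = z^-1.
Proof.
move=> k_gt0 zk1; have /eqP : `|z| ^+ k = 1 by rewrite -normrX zk1 normr1.
by rewrite pexpr_eq1 // invC_norm => /eqP->; rewrite expr1n invr1 mul1r.
Qed.

Lemma sum_unity_root_expr (K : fieldType) (k : nat) (z : K) :
  z ^+ k = 1 -> z != 1 -> \sum_(j < k) z ^+ j = 0.
Proof.
move=> zk1 z1; have := subrX1 z k; rewrite zk1 subrr => /esym/eqP.
by rewrite mulf_eq0 subr_eq0 (negPf z1) => /eqP.
Qed.

Lemma parseval_prim_root (C : numClosedFieldType) (k : nat) (z : C)
    (c : 'I_k -> int) : k.-primitive_root z ->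
  \sum_(j < k) `|\sum_i (c i)%:~R * (z ^+ j) ^+ i| ^+ 2 =
    (k%:Z * \sum_i c i ^+ 2)%:~R.
Proof.
move=> prim_z; have k_gt0 := prim_order_gt0 prim_z.
have z_neq0 : z != 0 by rewrite (prim_root_eq0 prim_z) -lt0n.
transitivity (\sum_(j < k) \sum_i \sum_l
    (c i * c l)%:~R * (z ^+ i / z ^+ l) ^+ j).
  apply: eq_bigr => j _; rewrite normCK rmorph_sum mulr_suml.
  apply: eq_bigr => i _; rewrite mulr_sumr; apply: eq_bigr => l _.
  rewrite !rmorphM /= rmorph_int !rmorphXn /= (conj_unity_root k_gt0); last first.
    exact: prim_expr_order.
  by rewrite exprMn !exprVn -!exprM ![(j * _)%N]mulnC; ring.
rewrite exchange_big rmorphM rmorph_sum /= mulr_sumr; apply: eq_bigr => i _.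
rewrite exchange_big (bigD1 i) //= [X in _ + X]big1 ?addr0 => [|l neq_li].
  rewrite -mulr_sumr divff ?expf_neq0 //; under eq_bigr do rewrite expr1n.
  by rewrite sumr_const card_ord expr2 mulrC.
rewrite -mulr_sumr sum_unity_root_expr ?mulr0 //.
  by rewrite exprMn exprVn -!exprM ![(_ * k)%N]mulnC !exprM
    (prim_expr_order prim_z) !expr1n divr1.
apply: contra neq_li => /eqP eq1; apply/eqP/val_inj/eqP=> /=.
have : z ^+ l = z ^+ i by rewrite -[RHS](divfK (expf_neq0 l z_neq0)) eq1 mul1r.
by move/eqP; rewrite (eq_prim_root_expr prim_z) !modn_small.
Qed.

(** * Lifting vanishing sums of roots of unity to characteristic 0 *)

(** As ['X^k - 1] is the product of the ['Phi_d] for [d] dividing [k], some ['Phi_d]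
  vanishes at [x]; but then [x ^+ d = 1], which forces [d = k]. *)
Lemma root_Cyclotomic_prim (K : fieldType) (k : nat) (x : K) :
  k.-primitive_root x -> root (map_poly intr 'Phi_k) x.
Proof.
move=> prim_x; have k_gt0 := prim_order_gt0 prim_x.
have prodE d : (0 < d)%N ->
    \prod_(t <- divisors d) (map_poly intr 'Phi_t).[x] = x ^+ d - 1.
  move=> d_gt0; rewrite -horner_prod -rmorph_prod prod_Cyclotomic //=.
  by rewrite rmorphB /= rmorph1 map_polyXn !hornerE.
have /eqP := prodE k k_gt0; rewrite (prim_expr_order prim_x) subrr.
rewrite prodf_seq_eq0 => /hasP[d]; rewrite -dvdn_divisors //= => dvd_dk Phi_d0.
have d_gt0 := dvdn_gt0 k_gt0 dvd_dk.
suff /eqP <- : d == k by [].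
rewrite eqn_dvd dvd_dk /= (prim_order_dvd prim_x) -subr_eq0 -prodE //.
rewrite prodf_seq_eq0; apply/hasP; exists d => //.
by rewrite -dvdn_divisors.
Qed.

Lemma inj_frobenius_orbit (K : fieldType) (k p : nat) (x : K) :
    (1 < k)%N -> coprime k p -> k.-primitive_root x ->
  injective (fun i : 'I_(ord_mod k p) => x ^+ (p ^ i)).
Proof.
move=> k_gt1 co_kp prim_x i j /eqP; rewrite (eq_prim_root_expr prim_x).
wlog le_ij : i j / (i <= j)%N.
  by move=> IH; case: (leqP i j) => [/IH//|/ltnW/IH IH' eq];
    apply/esym/IH'; rewrite eq_sym.
have prim_y : k.-primitive_root (x ^+ (p ^ i)).
  by rewrite prim_root_exp_coprime // coprime_sym coprimeXr.
rewrite -(eq_prim_root_expr prim_x) -(subnKC le_ij) expnD exprM -[_ ^+ (p ^ i)]expr1.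
rewrite (eq_prim_root_expr prim_y) eq_sym -ord_mod_dvdP // => dvd_ord.
apply/val_inj/eqP; rewrite /= eqn_leq le_ij -subn_eq0 -leqn0 leqNgt /=.
apply/negP=> gt0; have := dvdn_leq gt0 dvd_ord.
by rewrite leqNgt (leq_ltn_trans (leq_subr _ _) (ltn_ord j)).
Qed.

Lemma horner_int_frobenius (K : fieldType) (p : nat) (f : {poly int}) (x : K)
    (i : nat) : p \in [pchar K] ->
  (map_poly intr f).[x ^+ (p ^ i)] = (map_poly intr f).[x] ^+ (p ^ i).
Proof.
move=> charKp; elim: i => [|i IHi]; first by rewrite !expr1.
rewrite expnSr !exprM -IHi -!(pFrobenius_autE charKp) -horner_map /=.
congr _.[_]; rewrite -map_poly_comp; apply: eq_map_poly => n.
by rewrite /= rmorph_int.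
Qed.

Lemma ord_mod_le_totient (k p : nat) :
  (1 < k)%N -> coprime k p -> (ord_mod k p <= totient k)%N.
Proof.
move=> k_gt1 co_kp; apply: dvdn_leq; first by rewrite totient_gt0 ltnW.
by rewrite ord_mod_dvdP // Euler_exp_totient // coprime_sym.
Qed.

(** The norm [N] of the sum, computed in [Z[X] / 'Phi_k], would be a nonzero integer
  divisible by [p ^ ord_mod k p] if the conclusion failed.  The size of its
  conjugates, controlled on average by Parseval's identity, does not allow this.
  Some unspecified [zeta] is good enough for the applications, since all primitive
  [k]-th roots of unity satisfy the same multiplicative relations. *)
Lemma vanishing_sum_lifts (K : fieldType) (p k s : nat) (eta : K)
    (c : 'I_k -> int) :
    prime p -> p \in [pchar K] -> (1 < k)%N -> coprime k p ->
    k.-primitive_root eta ->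
    \sum_i c i ^+ 2 <= s%:Z ->
    ((s * k) ^ totient k < p ^ (2 * ord_mod k p) * totient k ^ totient k)%N ->
    \sum_i (c i)%:~R * eta ^+ i = 0 ->
  exists2 zeta : algC, k.-primitive_root zeta
                     & \sum_i (c i)%:~R * zeta ^+ i = 0.
Proof.
move=> pr_p charKp k_gt1 co_kp prim_eta le_s bound eta0.
have k_gt0 := ltnW k_gt1.
have [z prim_z] := C_prim_root_exists k_gt0.
pose J := [set j : 'I_k | coprime j k].
pose f : {poly int} := \sum_i (c i)%:P * 'X^i.
have fE (L : fieldType) (x : L) :
    (map_poly intr f).[x] = \sum_i (c i)%:~R * x ^+ i.
  rewrite rmorph_sum horner_sum; apply: eq_bigr => i _.
  by rewrite rmorphM /= map_polyC map_polyXn hornerM hornerC hornerXn.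
have cardJ : #|J| = totient k.
  rewrite totient_count_coprime -sum1_card big_mkcond /= big_mkord.
  by apply: eq_bigr => i _; rewrite inE coprime_sym; case: coprime.
have szPhi : size 'Phi_k = #|J|.+1 by rewrite size_Cyclotomic cardJ.
pose a : 'rV[algC]_#|J| := \row_(i < #|J|) z ^+ (@enum_val _ (mem J) i : 'I_k).
have prim_a i : k.-primitive_root (a 0 i).
  by rewrite mxE prim_root_exp_coprime //; have := enum_valP i; rewrite inE.
have inj_a : injective (a 0).
  move=> i j; rewrite !mxE => /eqP; rewrite (eq_prim_root_expr prim_z).
  by rewrite !modn_small // => /eqP/val_inj/enum_val_inj.
pose N := \det (mulmod_mx 'Phi_k f #|J|).
have N_prod : N%:~R = \prod_i (map_poly intr f).[a 0 i].
  apply: det_mulmod_mx szPhi _ inj_a; first exact: Cyclotomic_monic.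
  by move=> j; apply: root_Cyclotomic_prim.
have [N0|N_neq0] := eqVneq N 0.
  move: N_prod; rewrite N0 => /esym/eqP/prodf_eq0[i _ /eqP].
  by rewrite fE; exists (a 0 i).
have N_lower : (p ^ ord_mod k p <= absz N)%N.
  have := ord_mod_le_totient k_gt1 co_kp; rewrite -cardJ => le_dJ.
  pose b : 'rV[K]_(ord_mod k p) := \row_i eta ^+ (p ^ i).
  have inj_b : injective (b 0).
    by move=> i j; rewrite !mxE => /(inj_frobenius_orbit k_gt1 co_kp prim_eta).
  have prim_b i : k.-primitive_root (b 0 i).
    by rewrite mxE prim_root_exp_coprime // coprime_sym coprimeXr.
  have f_b i : (map_poly intr f).[b 0 i] = 0.
    rewrite mxE horner_int_frobenius // fE eta0 expr0n.
    by rewrite eqn0Ngt expn_gt0 prime_gt0.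
  apply: dvdn_leq; first by rewrite absz_gt0.
  apply: (dvdz_det_of_kernel pr_p charKp _ (rank_Vandermonde le_dJ inj_b)).
  rewrite mulmod_mx_Vandermonde // ?Cyclotomic_monic //; last first.
    by move=> j; apply: root_Cyclotomic_prim.
  rewrite (_ : diag_mx _ = 0); last first.
    by apply/matrixP=> i j; rewrite mxE mxE f_b mul0rn mxE.
  by rewrite mulmx0.
have N_upper : (absz N ^ 2 * totient k ^ totient k <= (s * k) ^ totient k)%N.
  pose E i := `|(map_poly intr f).[a 0 i]| ^+ 2.
  have E_ge0 i : 0 <= E i by rewrite exprn_ge0.
  have sumE : \sum_i E i <= (s * k)%:R.
    pose E' (j : 'I_k) := `|\sum_i (c i)%:~R * (z ^+ j) ^+ i| ^+ 2.
    have -> : \sum_i E i = \sum_(j in J) E' j.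
      by rewrite [RHS]big_enum_val; apply: eq_bigr => i _; rewrite /E mxE fE.
    (* Parseval's identity needs the sum over all powers of [z], primitive or not. *)
    apply: (@le_trans _ _ (\sum_j E' j)).
      by rewrite [leRHS](bigID (mem J)) /= lerDl sumr_ge0 // => j _; rewrite exprn_ge0.
    rewrite parseval_prim_root // mulnC natrM rmorphM /=.
    by rewrite ler_wpM2l // -[s%:R]/((s%:Z)%:~R) ler_int.
  have prodE : \prod_i (E i *+ #|J|) = (absz N ^ 2 * #|J| ^ #|J|)%:R.
    under eq_bigr do rewrite -mulr_natr.
    rewrite big_split /= prodrXl -normr_prod -N_prod prodr_const card_ord.
    by rewrite natrM !natrX -intr_norm natr_absz.
  have AGM : \prod_i (E i *+ #|J|) <= (\sum_i E i) ^+ #|J|.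
    have [|+ _] := @leif_AGM_scaled algC 'I_#|J| predT E.
      by move=> i _; rewrite mulrn_wge0.
    by rewrite card_ord.
  rewrite -cardJ -(ler_nat algC) -prodE natrX (le_trans AGM) //.
  by rewrite lerXn2r ?nnegrE ?sumr_ge0.
have : (p ^ (2 * ord_mod k p) * totient k ^ totient k <=
    absz N ^ 2 * totient k ^ totient k)%N.
  by rewrite leq_mul2r mulnC expnM leq_sqr N_lower orbT.
by move=> /leq_trans/(_ N_upper); rewrite leqNgt bound.
Qed.

(** Complex conjugation inverts roots of unity, so the equation also holds for the
  inverses: [(a + b) / (a b) = (c + d) / (c d)].  Unless the sum is 0, the pairs
  have the same sum and the same product. *)
Lemma unity_roots_add_eq (C : numClosedFieldType) (k : nat) (a b c d : C) :
    (0 < k)%N -> a ^+ k = 1 -> b ^+ k = 1 -> c ^+ k = 1 -> d ^+ k = 1 ->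
  a + b = c + d -> [\/ a = c, a = d | a + b = 0].
Proof.
move=> k_gt0 ak bk ck dk eq_sum.
have unit_root (x : C) : x ^+ k = 1 -> x != 0.
  by move=> xk; have : x ^+ k != 0; [rewrite xk oner_eq0 | rewrite expf_eq0 k_gt0].
have [[[a0 b0] c0] d0] :=
  (unit_root _ ak, unit_root _ bk, unit_root _ ck, unit_root _ dk).
have eq_inv : a^-1 + b^-1 = c^-1 + d^-1.
  have := congr1 Num.conj eq_sum.
  by rewrite !rmorphD /= !(@conj_unity_root _ k).
have /eqP : (a + b) * (c * d - a * b) = 0.
  have -> : (a + b) * (c * d - a * b) =
      a * b * c * d * ((a^-1 + b^-1) - (c^-1 + d^-1)) + a * b * (c + d - (a + b)).
    by field; rewrite a0 b0 c0 d0.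
  by rewrite eq_inv eq_sum !subrr !mulr0 addr0.
rewrite mulf_eq0 subr_eq0 => /orP[/eqP ab0|/eqP cd_ab]; first by constructor 3.
have : (a - c) * (a - d) == 0.
  have -> : (a - c) * (a - d) = a * (a + b - (c + d)) + (c * d - a * b) by ring.
  by rewrite eq_sum cd_ab !subrr mulr0 addr0.
by rewrite mulf_eq0 !subr_eq0 => /orP[] /eqP; [constructor 1 | constructor 2].
Qed.

(** * The coordinate in which related solutions differ by a translation *)

(** This homography sends [1] to infinity, so that [x |-> 2 - x^-1], which is
  parabolic with fixed point [1], becomes a translation.  The constant [2^-1]
  makes [x |-> x^-1] become the opposite. *)
Definition cayley (K : fieldType) (x : K) : K := (x - 1)^-1 + 2^-1.

(** The relation between the coordinates of two solutions: the first case is that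
  of inverse solutions, the second one comes from relations with a double
  term. *)
Definition related (K : fieldType) (v w : K) : Prop :=
  v + w = 0 \/ (3 : K) != 0 /\ (w = v + 1 \/ v = w + 1).

Lemma related_sym (K : fieldType) (v w : K) : related v w -> related w v.
Proof. by rewrite /related addrC; case=> [|[? [|]]]; [left|right|right]; auto. Qed.

Lemma related_opp (K : fieldType) (w v : K) :
    (2 : K) != 0 -> v != w -> v != - w -> w != - w ->
    related w v -> related (- w) v ->
  v = 0 /\ w \in [:: 1; -1].
Proof.
move=> nz2 v_w v_Nw w_Nw; rewrite /related !inE.
case=> [/eqP|[_ wv]]; first by rewrite addr_eq0 -eqr_oppLR eq_sym (negPf v_Nw).
case=> [/eqP|[_ Nwv]]; first by rewrite addrC subr_eq0 (negPf v_w).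
have cancel2 (x y : K) : 2 * x = 2 * y -> x = y by apply: mulfI.
case: wv Nwv => wv [] Nwv.
- by case/eqP: w_Nw; apply: (addIr 1); rewrite -wv.
- have w1 : w = -1.
    by apply: cancel2; rewrite [LHS](_ : _ = w - (- w)); [rewrite Nwv wv|]; ring.
  by rewrite wv w1; split; [ring | rewrite eqxx orbT].
- have w1 : 1 = w.
    by apply: cancel2; rewrite [RHS](_ : _ = w + w); [rewrite {1}wv Nwv |]; ring.
  by rewrite Nwv -w1; split; [ring | rewrite eqxx].
- by case/eqP: w_Nw; rewrite Nwv.
Qed.

(** If two of the three values are opposite, [related_opp] concludes.  Otherwise all
  differences are [1] or [-1]; as they add up around the triangle, a sum
  of two signs would be a sign, which forces [3 = 0], the excluded case. *)
Lemma related_triple (K : fieldType) (x y z : K) :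
    (2 : K) != 0 -> uniq [:: x; y; z] ->
    related x y -> related y z -> related x z ->
  x \in [:: 0; 1; -1].
Proof.
move=> nz2; rewrite /= !inE negb_or andbT => /andP[/andP[neq_xy neq_xz] neq_yz].
move=> xy yz xz.
have [/eqP|nz_xy] := eqVneq (x + y) 0.
  rewrite addrC addr_eq0 => /eqP y_eq; subst y.
  rewrite eq_sym in neq_xz; rewrite eq_sym in neq_yz.
  have [_] := related_opp nz2 neq_xz neq_yz neq_xy xz yz.
  by rewrite !inE => ->; rewrite orbT.
have [/eqP|nz_xz] := eqVneq (x + z) 0.
  rewrite addrC addr_eq0 => /eqP z_eq; subst z.
  rewrite eq_sym in neq_xy.
  have [_] := related_opp nz2 neq_xy neq_yz neq_xz xy (related_sym yz).
  by rewrite !inE => ->; rewrite orbT.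
have [/eqP|nz_yz] := eqVneq (y + z) 0.
  rewrite addrC addr_eq0 => /eqP z_eq; subst z.
  have [-> _] := related_opp nz2 neq_xy neq_xz neq_yz (related_sym xy) (related_sym xz).
  by rewrite eqxx.
have step (u v : K) : u + v != 0 -> related u v ->
    (3 : K) != 0 /\ (v - u = 1 \/ v - u = -1).
  move=> nz [/eqP|[nz3 uv]]; first by rewrite (negPf nz).
  by split=> //; case: uv => ->; [left | right]; ring.
have [nz3 xy1] := step _ _ nz_xy xy; have [_ yz1] := step _ _ nz_yz yz.
have [_ xz1] := step _ _ nz_xz xz.
have : (z - x) ^+ 2 = 1 by case: xz1 => ->; rewrite ?sqrrN expr1n.
have -> : z - x = (y - x) + (z - y) by ring.
have [nz1 nz2'] : (0 : K) ^+ 2 != 1 /\ (2 : K) ^+ 2 != 1.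
  rewrite expr0n eq_sym oner_eq0 -subr_eq0; split=> //.
  by rewrite (_ : _ - 1 = 3) //; ring.
by case: xy1 yz1 => -> [] -> /eqP;
  rewrite ?subrr ?addNr ?(negPf nz1) // -?opprD ?sqrrN (negPf nz2').
Qed.

(** * Additive relations between roots of unity in large characteristic *)

Section LargeCharacteristic.

Variables (K : fieldType) (p k : nat) (eta : K).
Hypotheses (pr_p : prime p) (charKp : p \in [pchar K]).
Hypotheses (k_gt1 : (1 < k)%N) (co_kp : coprime k p).
Hypothesis prim_eta : k.-primitive_root eta.
Hypothesis bound :
  ((4 * k) ^ totient k < p ^ (2 * ord_mod k p) * totient k ^ totient k)%N.

Let k_gt0 : (0 < k)%N := ltnW k_gt1.

(** As [ord_mod k p <= totient k <= k], the right-hand side of the bound is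
  at most [4 ^ totient k * k ^ totient k] for [p = 2]. *)
Lemma large_characteristic_neq2 : p != 2.
Proof.
apply: contraTneq bound => p2; rewrite -leqNgt p2 expnM expnMn leq_mul //.
  by rewrite leq_exp2l // -p2 ord_mod_le_totient.
rewrite leq_exp2r ?totient_gt0 // totient_count_coprime big_mkord.
by rewrite -[leqRHS]card_ord -sum1_card leq_sum // => i _; apply: leq_b1.
Qed.

Lemma two_neq0 : (2 : K) != 0.
Proof.
by rewrite -(dvdn_pcharf charKp) dvdn_prime2 // large_characteristic_neq2.
Qed.

(** Disjoint lists without repetition make all coefficients of the difference of the
  two sums [1] or [-1], so that the sum of their squares is the number of
  terms. *)
Lemma equal_power_sums_lift (s t : seq 'I_k) :
    uniq (s ++ t) -> (size (s ++ t) <= 4)%N ->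
    \sum_(i <- s) eta ^+ i = \sum_(i <- t) eta ^+ i ->
  exists2 zeta : algC, k.-primitive_root zeta
                     & \sum_(i <- s) zeta ^+ i = \sum_(i <- t) zeta ^+ i.
Proof.
move=> uniq_st size_st eq_st.
pose c (i : 'I_k) : int := (i \in s)%:R - (i \in t)%:R.
have [uniq_s uniq_t] : uniq s /\ uniq t by move: uniq_st; rewrite cat_uniq => /and3P[].
have sum_mem (L : fieldType) (x : L) (r : seq 'I_k) : uniq r ->
    \sum_i ((i \in r)%:R : int)%:~R * x ^+ i = \sum_(i <- r) x ^+ i.
  move=> uniq_r; rewrite [RHS]big_uniq //= [RHS]big_mkcond.
  by apply: eq_bigr => i _; case: (i \in r); rewrite ?mul1r ?mul0r.
have cE (L : fieldType) (x : L) : \sum_i (c i)%:~R * x ^+ i =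
    \sum_(i <- s) x ^+ i - \sum_(i <- t) x ^+ i.
  under eq_bigr do rewrite rmorphB mulrBl.
  by rewrite sumrB !sum_mem.
have [||zeta prim_z] :=
  vanishing_sum_lifts (c := c) pr_p charKp k_gt1 co_kp prim_eta _ bound.
- apply: (@le_trans _ _ (\sum_i (i \in s ++ t)%:R)); last first.
    rewrite -natr_sum natz lez_nat; apply: leq_trans size_st.
    rewrite -(card_uniqP uniq_st) -sum1_card [leqRHS]big_mkcond /=.
    by apply: leq_sum => i _; case: (i \in s ++ t).
  apply: ler_sum => i _; rewrite /c mem_cat.
  by case: (i \in s); case: (i \in t).
- by rewrite cE eq_st subrr.
by rewrite cE => /eqP; rewrite subr_eq0 => /eqP; exists zeta.
Qed.

(** In the lifted relation, distinct exponents rule out equal terms, so two opposite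
  complex terms remain.  Being opposite is transported back to [K] as having the
  same square and being distinct. *)
Lemma add_unity_roots_eq0 (u v s t : K) :
    u ^+ k = 1 -> v ^+ k = 1 -> s ^+ k = 1 -> t ^+ k = 1 ->
    uniq [:: u; v; s; t] -> u + v = s + t ->
  u + v = 0.
Proof.
move=> /(prim_rootP prim_eta)[iu ->] /(prim_rootP prim_eta)[iv ->].
move=> /(prim_rootP prim_eta)[i_s ->] /(prim_rootP prim_eta)[it ->].
move=> uniq_uvst eq_sum.
have uniq_i : uniq ([:: iu; iv] ++ [:: i_s; it]).
  by apply: (@map_uniq _ _ (fun i : 'I_k => eta ^+ i)).
have [//||zeta prim_z] := equal_power_sums_lift uniq_i;
  rewrite !big_cons !big_nil !addr0 // => eq_z.
have transport (i j : 'I_k) : zeta ^+ i = zeta ^+ j -> i = j.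
  by move/eqP; rewrite (eq_prim_root_expr prim_z) !modn_small // => /eqP/val_inj.
have zk i : (zeta ^+ i) ^+ k = 1 by rewrite exprAC (prim_expr_order prim_z) expr1n.
move: uniq_i; rewrite /= !inE !negb_or.
have [/transport->|/transport->|z0] :=
  unity_roots_add_eq k_gt0 (zk _) (zk _) (zk _) (zk _) eq_z.
- by rewrite eqxx andbF.
- by rewrite eqxx !andbF.
case/and3P => /and3P[neq_uv _ _] _ _.
have /eqP : (zeta ^+ iu) ^+ 2 = (zeta ^+ iv) ^+ 2.
  by move/eqP: z0; rewrite addr_eq0 => /eqP->; rewrite sqrrN.
rewrite -!exprM (eq_prim_root_expr prim_z) -(eq_prim_root_expr prim_eta) !exprM.
rewrite eqf_sqr (eq_prim_root_expr prim_eta) !modn_small //.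
rewrite (inj_eq val_inj) (negPf neq_uv) /=.
by rewrite -addr_eq0 => /eqP.
Qed.

(** Over the complex numbers, conjugating [1 + a + b = 0] gives [a b = 1], so [a] is a
  root of ['X^2 + 'X + 1]; the order of [a] is also the order of [u]. *)
Lemma add_unity_roots_1_cube (u v : K) :
    u ^+ k = 1 -> v ^+ k = 1 -> uniq [:: 1; u; v] -> 1 + u + v = 0 ->
  u ^+ 3 = 1.
Proof.
move=> /(prim_rootP prim_eta)[iu ->] /(prim_rootP prim_eta)[iv ->] uniq_uv eq0.
pose i0 := Ordinal k_gt0.
have uniq_i : uniq ([:: i0; iu; iv] ++ [::]).
  by apply: (@map_uniq _ _ (fun i : 'I_k => eta ^+ i)).
have [//||zeta prim_z] := equal_power_sums_lift uniq_i;
  rewrite !big_cons !big_nil !addr0 addrA // => z0.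
rewrite expr0 in z0; set a := zeta ^+ iu in z0 *; set b := zeta ^+ iv in z0.
have zk i : (zeta ^+ i) ^+ k = 1 by rewrite exprAC (prim_expr_order prim_z) expr1n.
have nz i : zeta ^+ i != 0 by rewrite expf_neq0 // (prim_root_eq0 prim_z) -lt0n.
have inv0 : 1 + a^-1 + b^-1 = 0.
  have := congr1 Num.conj z0.
  by rewrite !rmorphD rmorph0 rmorph1 /= !(conj_unity_root k_gt0 (zk _)).
have /eqP : a ^+ 3 = 1.
  have ab1 : a * b = 1.
    have : a * b * (1 + a^-1 + b^-1) = 0 by rewrite inv0 mulr0.
    have -> : a * b * (1 + a^-1 + b^-1) = a * b + (1 + a + b) - 1.
      by field; rewrite !nz.
    by rewrite z0 addr0 => /eqP; rewrite subr_eq0 => /eqP.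
  have -> : a ^+ 3 = (a ^+ 2 - a) * (1 + a + b) + a * b * (1 - a) + a by ring.
  by rewrite z0 ab1; ring.
rewrite /a -exprM -(prim_order_dvd prim_z) (prim_order_dvd prim_eta) exprM.
by move/eqP.
Qed.

(** In characteristic 3 the hypothesis reads [1 + x + x * y = 0].  This forces
  [x ^+ 3 = 1], that is, [(x - 1) ^+ 3 = 0]. *)
Lemma degenerate_pair (x y : K) :
    x ^+ k = 1 -> y ^+ k = 1 -> x != 1 -> y != 1 -> x * (y - 1) = x - 1 ->
  (3 : K) != 0 /\ y + x^-1 = 2.
Proof.
move=> xk yk x1 y1 eq_xy.
have x0 : x != 0.
  by have : x ^+ k != 0; [rewrite xk oner_eq0 | rewrite expf_eq0 k_gt0].
split; last first.
  apply: (mulfI x0); rewrite mulrDr divff //.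
  by rewrite (_ : x * y = x * (y - 1) + x); [rewrite eq_xy | ]; ring.
apply/negP=> /eqP three0.
have x3 : x ^+ 3 = 1.
  apply: (@add_unity_roots_1_cube x (x * y)) => //.
  - by rewrite exprMn xk yk mulr1.
  - rewrite /= !inE negb_or eq_sym x1 /= andbT; apply/andP; split.
      apply: contra x1 => /eqP xy1; move: eq_xy; rewrite mulrBr -xy1 mulr1 => eq_x.
      rewrite -subr_eq0 -(mulrI_eq0 _ (mulfI two_neq0)).
      by rewrite (_ : 2 * (x - 1) = (x - 1) - (1 - x)); [rewrite eq_x subrr | ring].
    by rewrite -{1}[x]mulr1 (inj_eq (mulfI x0)) eq_sym.
  rewrite (_ : 1 + x + x * y = (x * (y - 1) - (x - 1)) + 3 * x); last by ring.
  by rewrite eq_xy three0 subrr mul0r addr0.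
case/negP: x1; rewrite -subr_eq0; suff : (x - 1) ^+ 3 == 0 by rewrite expf_eq0.
rewrite (_ : (x - 1) ^+ 3 = x ^+ 3 - 1 - 3 * (x ^+ 2 - x)); last by ring.
by rewrite x3 three0 subrr mul0r subr0.
Qed.

(** With [z] the given quotient, [x + z = 1 + z * y].  The two degenerate cases are
  the coincidences [x = z] and [1 = z * y]; they are exchanged by swapping [x]
  and [y], which inverts [z]. *)
Lemma related_cayley (x y : K) :
    x ^+ k = 1 -> y ^+ k = 1 -> x != 1 -> y != 1 -> x != y ->
    ((x - 1) / (y - 1)) ^+ k = 1 ->
  related (cayley x) (cayley y).
Proof.
move=> xk yk x1 y1 neq_xy zk; set z := _ / _ in zk.
have nz2 := two_neq0.
have unit_root (u : K) : u ^+ k = 1 -> u != 0.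
  by move=> uk; have : u ^+ k != 0; [rewrite uk oner_eq0 | rewrite expf_eq0 k_gt0].
have [x0 y0 z0] := And3 (unit_root x xk) (unit_root y yk) (unit_root z zk).
have [x1' y1'] : x - 1 != 0 /\ y - 1 != 0 by rewrite !subr_eq0.
have defz : z * (y - 1) = x - 1 by rewrite divfK.
rewrite /related /cayley.
have [xz|neq_xz] := eqVneq x z.
  have [|nz3 eq2] := degenerate_pair xk yk x1 y1; first by rewrite {1}xz.
  right; split=> //; left; apply/eqP; rewrite -subr_eq0; apply/eqP.
  have y_eq : y - 1 = 1 - x^-1 by rewrite -[y](addrK x^-1) eq2; ring.
  rewrite y_eq; field.
  by rewrite nz2 x1' x0.
have [zy1|neq_zy] := eqVneq 1 (z * y).
  have [|nz3 eq2] := degenerate_pair yk xk y1 x1.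
    by rewrite -defz mulrCA mulrA -zy1 mul1r.
  right; split=> //; right; apply/eqP; rewrite -subr_eq0; apply/eqP.
  have x_eq : x - 1 = 1 - y^-1 by rewrite -[x](addrK y^-1) eq2; ring.
  rewrite x_eq; field.
  by rewrite nz2 y1' y0.
have neq_z1 : z != 1.
  by apply: contra neq_xy => /eqP z1; move: defz; rewrite z1 mul1r => /addIr->.
have /eqP xz0 : x + z = 0.
  apply: (add_unity_roots_eq0 (s := 1) (t := z * y) xk zk).
  - exact: expr1n.
  - by rewrite exprMn zk yk mulr1.
  - rewrite /= !inE !negb_or neq_xz x1 neq_z1 neq_zy /= !andbT.
    apply/andP; split.
      apply: contra neq_z1 => /eqP x_zy.
      have := defz; rewrite mulrBr mulr1 -x_zy => /addrI/eqP.
      by rewrite eqr_opp.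
    by rewrite -{1}[z]mulr1 (inj_eq (mulfI z0)) eq_sym.
  by rewrite (_ : z * y = z * (y - 1) + z); [rewrite defz | ]; ring.
left; move: xz0; rewrite addrC addr_eq0 => /eqP z_eq.
have xy1 : x * y = 1.
  apply/eqP; rewrite -subr_eq0 (_ : _ - 1 = x - 1 - (- x) * (y - 1)); last by ring.
  by rewrite -z_eq defz subrr.
apply: (mulfI (mulf_neq0 nz2 (mulf_neq0 x1' y1'))); rewrite mulr0.
transitivity (2 * (x * y - 1)); last by rewrite xy1 subrr mulr0.
by field; rewrite nz2 x1' y1'.
Qed.

End LargeCharacteristic.

(** * Counting the solutions *)

Lemma pairwise_related_le3 (F : finFieldType) (W : {set F}) :
    (2 : F) != 0 -> {in W &, forall v w, v != w -> related v w} ->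
  (#|W| <= 3)%N /\ ((2 < #|W|)%N -> 0 \in W /\ 1 \in W).
Proof.
move=> nz2 relW; pose T : {set F} := [set v in [:: 0; 1; -1]].
have cardT : (#|T| <= 3)%N by rewrite cardsE; apply: (card_size [:: 0; 1; -1]).
case: (leqP #|W| 2) => [leW2|]; first by rewrite (leq_trans leW2).
move=> gt2; suff subWT : W \subset T.
  split; first exact: leq_trans (subset_leq_card subWT) cardT.
  move=> _; suff -> : W = T by rewrite !inE !eqxx orbT.
  by apply/eqP; rewrite eqEcard subWT (leq_trans cardT).
have inT x y z : x \in W -> y \in W -> z \in W -> uniq [:: x; y; z] -> x \in T.
  move=> Wx Wy Wz uniq_xyz; rewrite inE; apply: (related_triple nz2 uniq_xyz);
  apply: relW => //; move: uniq_xyz; rewrite /= !inE negb_or andbT => /andP[/andP[]] //.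
have [x [y [z [[Wx Wy Wz] [xy yz zx]]]]] := card_gt2P gt2.
apply/subsetP=> t Wt.
have [t_x|t_x] := eqVneq t x.
  by rewrite t_x (inT x y z) //= !inE negb_or xy yz eq_sym zx.
have [t_y|t_y] := eqVneq t y.
  by rewrite t_y (inT y z x) //= !inE negb_or yz zx eq_sym xy.
by rewrite (inT t x y) //= !inE negb_or t_x t_y xy.
Qed.

Lemma generator_prim_root (F : finFieldType) (g : {unit F}) :
  generator [set: {unit F}] g -> #|F|.-1.-primitive_root (val g).
Proof.
move=> /eqP gen_g; rewrite -card_finField_unit gen_g -orderE.
have g1 : val g ^+ #[g]%g = 1 by rewrite -FinRing.val_unitX expg_order.
have [m prim_m dvd_m] := prim_order_exists (order_gt0 g) g1.
suff /eqP -> : #[g]%g == m by [].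
rewrite eqn_dvd dvd_m andbT order_dvdn; apply/eqP/val_inj.
by rewrite FinRing.val_unitX (prim_expr_order prim_m).
Qed.

(** Since [val g ^+ e] is a [k]-th root of unity, the [k]-th power is constant on a
  class; this is what makes quotients of elements of a class roots of unity. *)
Lemma cyclotomic_class_expr (F : finFieldType) (g : {unit F}) (e k : nat)
    (a : int) (x : F) :
    val g ^+ (e * k) = 1 -> x \in cyclotomic_class g e k a ->
  x ^+ k = (val g ^ a) ^+ k.
Proof.
move=> g1 /imsetP[i _ ->]; have g_neq0 : val g != 0 by rewrite -unitfE (valP g).
by rewrite expfzDr // exprMn -!exprnP mulnC -!exprM mulnAC exprM g1 expr1n mulr1.
Qed.

Lemma cyclotomic_class_neq0 (F : finFieldType) (g : {unit F}) (e k : nat)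
    (a : int) (x : F) : x \in cyclotomic_class g e k a -> x != 0.
Proof.
case/imsetP=> i _ ->; rewrite expfz_neq0 //.
by rewrite -unitfE (valP g).
Qed.

(** Raising to the power [2 * d] clears the denominators of the exponent and of the
  base. *)
Lemma bound_in_nat (R : realType) (p k d : nat) : (0 < k)%N -> (0 < d)%N ->
    (4 * k%:R / (totient k)%:R) `^ ((totient k)%:R / (2 * d%:R)) < p%:R :> R ->
  ((4 * k) ^ totient k < p ^ (2 * d) * totient k ^ totient k)%N.
Proof.
move=> k_gt0 d_gt0 lt_p.
have phi_gt0 : 0 < (totient k)%:R :> R by rewrite ltr0n totient_gt0.
have base_ge0 : 0 <= 4 * k%:R / (totient k)%:R :> R by rewrite divr_ge0 ?mulr_ge0.
have d2_neq0 : 2 * d%:R != 0 :> R by rewrite mulf_neq0 ?pnatr_eq0 -?lt0n.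
have : ((4 * k%:R / (totient k)%:R) `^ ((totient k)%:R / (2 * d%:R))) ^+ (2 * d)
     < p%:R ^+ (2 * d) :> R.
  by rewrite ltrXn2r ?powR_ge0 // muln_eq0 /= -lt0n.
rewrite -[X in X < _]powR_mulrn ?powR_ge0 // -powRrM natrM divfK // powR_mulrn //.
rewrite expr_div_n ltr_pdivrMr ?exprn_gt0 // -natrM -!natrX -natrM ltr_nat.
by [].
Qed.

Theorem theorem5p4 (R : realType) (p n q e k : nat)
    (hp : prime p) (hn : (0 < n)%N) (hq : q = (p ^ n)%N)
    (he : nontrivial_divisor e q.-1) (hk : nontrivial_divisor k q.-1)
    (hqek : q = (e * k + 1)%N)
    (F : finFieldType) (hF : #|F| = q)
    (g : {unit F}) (hg : generator [set: {unit F}] g)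
    (a : nat) (ha : (1 <= a <= e.-1)%N)
    (hbound : (4 * k%:R / (totient k)%:R)
                `^ ((totient k)%:R / (2 * (ord_mod k p)%:R)) < p%:R :> R) :
  [/\ (2 : F) \in cyclotomic_class g e k a -> (2 %| k)%N ->
        (cyclotomic_number g e k a 0 <= 3)%N,
      (2 : F) \notin cyclotomic_class g e k a -> (2 %| k)%N ->
        (cyclotomic_number g e k a 0 <= 2)%N
    & ~~ (2 %| k)%N ->
        (cyclotomic_number g e k a 0 <= 2)%N].
Proof.
have charFp : p \in [pchar F] by apply: (card_finPcharP (n := n)); rewrite // hF hq.
have q1 : q.-1 = (e * k)%N by rewrite hqek addn1.
have q_gt1 : (1 < q)%N by rewrite hq -(exp1n n) ltn_exp2r // prime_gt1.
have [k_dvd k_neq1 _] := hk.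
have k_gt1 : (1 < k)%N.
  have := dvdn_gt0 _ k_dvd; rewrite -subn1 subn_gt0 => /(_ q_gt1).
  by case: (k) k_neq1 => [|[]].
have k_gt0 := ltnW k_gt1.
have co_kp : coprime k p.
  rewrite coprime_sym prime_coprime //; apply/negP=> p_dvd_k.
  have : (p %| q)%N by rewrite hq dvdn_exp.
  by rewrite hqek dvdn_addr ?dvdn_mull // dvdn1 => /eqP p1; rewrite p1 in hp.
have prim_g := generator_prim_root hg; rewrite hF q1 in prim_g.
have g1 := prim_expr_order prim_g.
have prim_eta : k.-primitive_root (val g ^+ e).
  have := dvdn_prim_root prim_g (dvdn_mull e (dvdnn k)).
  by rewrite mulnK.
have bound := bound_in_nat k_gt0 (order_gt0 _) hbound.
have nz2 := two_neq0 hp charFp k_gt1 co_kp bound.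
rewrite /cyclotomic_number; set S := finset _.
have S_P xy : xy \in S -> [/\ xy.1 \in cyclotomic_class g e k a,
    xy.1 = xy.2 - 1, xy.2 ^+ k = 1 & xy.2 != 1].
  rewrite inE => /and3P[Cx Cy /eqP eq_xy].
  rewrite -eq_xy [1 + _]addrC addrK; split=> //.
    by rewrite addrC eq_xy (cyclotomic_class_expr g1 Cy) expr1n.
  by rewrite -subr_eq0 addrK (cyclotomic_class_neq0 Cx).
pose W := [set cayley xy.2 | xy in S].
have cardW : #|W| = #|S|.
  apply: card_in_imset => [[x1 y1] [x2 y2]] /S_P[/= _ -> _ _] /S_P[/= _ -> _ _].
  by move=> /addIr/invr_inj/addIr->.
have relW : {in W &, forall v w, v != w -> related v w}.
  move=> _ _ /imsetP[xy1 /S_P[C1 e1 yk1 n1] ->] /imsetP[xy2 /S_P[C2 e2 yk2 n2] ->] neq.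
  apply: (related_cayley hp charFp k_gt1 co_kp prim_eta bound) => //.
    by apply: contraNneq neq => ->.
  rewrite -e1 -e2 exprMn exprVn (cyclotomic_class_expr g1 C1).
  by rewrite -(cyclotomic_class_expr g1 C2) divff // expf_neq0 //
    (cyclotomic_class_neq0 C2).
have [le3 gt2] := pairwise_related_le3 nz2 relW; rewrite cardW in le3 gt2.
(* The coordinate [0] is that of [y = -1], a [k]-th root of unity. *)
have even_k : (2 < #|S|)%N -> (2 %| k)%N.
  move=> /gt2[/imsetP[xy /S_P[_ _ yk n1] eq0] _].
  have y_eq : xy.2 - 1 = -2.
    by apply: invr_inj; apply/eqP; rewrite invrN -addr_eq0 eq_sym; apply/eqP.
  have yN1 : xy.2 = -1 by rewrite -[xy.2](subrK 1) y_eq; ring.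
  apply: contraLR nz2; rewrite dvdn2 !negbK => odd_k.
  by move: yk; rewrite yN1 -signr_odd odd_k expr1 => /eqP; rewrite eq_sym -subr_eq0 opprK.
(* The coordinate [1] is that of [y = 3], that is, of [y - 1 = 2]. *)
have two_in : (2 < #|S|)%N -> 2 \in cyclotomic_class g e k a.
  move=> /gt2[_ /imsetP[xy /S_P[Cx e1 _ n1] eq1]].
  suff <- : xy.1 = 2 by [].
  apply: invr_inj; apply: (addIr 2^-1); rewrite e1 -[LHS]eq1.
  by field.
split=> [// | two_notin _ | odd_k]; rewrite leqNgt.
  by apply: contra two_notin => /two_in.
by apply: contra odd_k => /even_k.
Qed.
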